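(* Let $d \in \mathbb{N}$ and let $\mathcal{K}$ be a finite set of positive integers. For $r \ge 0$ let $S_d(r) = \{\mathbf{s} = (s_1, \ldots, s_d) \in \mathbb{Z}_{\ge 0}^d : s_1 + \cdots + s_d = r\}$. Suppose $\alpha_0 \in \mathcal{R}$ and $\alpha_{\mathbf{s}} \in \mathcal{R}$ for $\mathbf{s} \in S_d(r)$, $r \in \mathcal{K} \cup \{0\}$, and let \[ P(u_1, \ldots, u_d) = \alpha_0 + \sum_{r \in \mathcal{K} \cup \{0\}} \sum_{\mathbf{s} \in S_d(r)} \alpha_{\mathbf{s}} \prod_{j=1}^d u_j^{s_j} \in \mathcal{R}[u_1, \ldots, u_d]. \] Suppose that for some $k \in \mathcal{K}$ and some $\mathbf{l} \in S_d(k)$: (i) $p \nmid k$; (ii) for every positive integer $v$, $p^v k \notin \mathcal{K}$; (iii) $\alpha_{\mathbf{l}} \notin \mathcal{Q}$. Then the sequence $(P(\mathbf{u}) \bmod \mathcal{Z})_{\mathbf{u} \in \mathcal{Z}^d}$ is well-distributed in $\mathcal{T}$.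
   Context: Fix a finite field $\mathbb{F}_q$ of characteristic $p$. Let $\mathcal{Z} = \mathbb{F}_q[t]$, $\mathcal{Q} = \mathbb{F}_q(t)$, $\mathcal{R} = \mathbb{F}_q((t^{-1}))$ (formal Laurent series in $t^{-1}$, the completion of $\mathcal{Q}$ for $|u/v| = q^{\deg u - \deg v}$), and $\mathcal{T} = \mathcal{R}/\mathcal{Z}$; each element of $\mathcal{T}$ has a unique representative $\sum_{n=-\infty}^{-1} c_n t^n$. For $M \in \mathbb{N}$ and $a_1, \ldots, a_M \in \mathbb{F}_q$, the cylinder set $C(M; a_1, \ldots, a_M) \subseteq \mathcal{T}$ consists of the elements whose representative has $c_{-1} = a_1, \ldots, c_{-M} = a_M$. A Følner sequence in $\mathcal{Z}^d$ is a sequence $(F_N)$ of finite nonempty subsets of $\mathcal{Z}^d$ with $|F_N \cap (F_N + \mathbf{u})|/|F_N| \to 1$ for every $\mathbf{u} \in \mathcal{Z}^d$. A sequence $(a(\mathbf{u}))_{\mathbf{u} \in \mathcal{Z}^d}$ in $\mathcal{T}$ is well-distributed if for every Følner sequence $(F_N)$ in $\mathcal{Z}^d$, every $M \in \mathbb{N}$ and all $a_1, \ldots, a_M \in \mathbb{F}_q$, $|\{\mathbf{u} \in F_N : a(\mathbf{u}) \in C(M; a_1, \ldots, a_M)\}|/|F_N| \to q^{-M}$. *)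

(* Defs.v *)
From HB Require Import structures.
From mathcomp Require Import all_boot all_order all_algebra all_field.
From mathcomp Require Import finmap.
Set Implicit Arguments. Unset Strict Implicit. Unset Printing Implicit Defensive.
Import Order.TTheory GRing.Theory Num.Theory.
Local Open Scope ring_scope.

(* Elements of R = F_q((t^{-1})) are represented by their coefficient
   functions  a : int -> F  (a n = coefficient of t^n), required to vanish
   for all sufficiently large n. *)
Definition laurent (F : finFieldType) := int -> F.

Definition is_laurent (F : finFieldType) (a : laurent F) : Prop :=
  exists N : int, forall n : int, N < n -> a n = 0.

Definition poly_laurent (F : finFieldType) (f : {poly F}) : laurent F :=
  fun n => if (0 <= n)%R then f`_(absz n) else 0.

Definition mulpl (F : finFieldType) (f : {poly F}) (a : laurent F) : laurent F :=
  fun n => \sum_(i < size f) f`_i * a (n - (i : nat)%:Z).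

Definition in_Q (F : finFieldType) (a : laurent F) : Prop :=
  exists f g : {poly F}, g != 0 /\ mulpl g a = poly_laurent f.

Definition evalP (F : finFieldType) (d : nat) (K : seq nat)
  (alpha0 : laurent F) (alpha : {ffun 'I_d -> nat} -> laurent F)
  (u : {ffun 'I_d -> {poly F}}) : laurent F :=
  fun n => alpha0 n +
    \sum_(r <- 0%N :: K)
      \sum_(s : {ffun 'I_d -> 'I_r.+1} | (\sum_(j < d) (s j : nat) == r)%N)
        mulpl (\prod_(j < d) (u j) ^+ (s j)) (alpha [ffun j => (s j : nat)]) n.

Definition ftranslate (F : finFieldType) (d : nat)
  (A : {fset {ffun 'I_d -> {poly F}}}) (v : {ffun 'I_d -> {poly F}}) :=
  [fset (x + v)%R | x in A]%fset.

Definition rat_cvg (x : nat -> rat) (l : rat) : Prop :=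
  forall eps : rat, 0 < eps -> exists N0 : nat, forall N, (N0 <= N)%N -> `|x N - l| < eps.

Definition folner (F : finFieldType) (d : nat)
  (Fo : nat -> {fset {ffun 'I_d -> {poly F}}}) : Prop :=
  (forall N, (Fo N != fset0)%fset) /\
  forall v : {ffun 'I_d -> {poly F}},
    rat_cvg (fun N => (#|` (Fo N `&` ftranslate (Fo N) v)%fset|%:R / #|` Fo N|%:R : rat)) 1.

(* x lies in the cylinder C(M; a_1,...,a_M) of T = R/Z  (a m = a_{m+1}) *)
Definition in_cylinder (F : finFieldType) (M : nat) (a : 'I_M -> F) (x : laurent F) : bool :=
  [forall m : 'I_M, x (- (m.+1 : nat)%:Z) == a m].

Definition well_distributed (F : finFieldType) (d : nat)
  (x : {ffun 'I_d -> {poly F}} -> laurent F) : Prop :=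
  forall Fo : nat -> {fset {ffun 'I_d -> {poly F}}}, folner Fo ->
  forall (M : nat) (a : 'I_M -> F),
    rat_cvg (fun N => (#|` [fset u in Fo N | in_cylinder a (x u)]%fset|%:R / #|` Fo N|%:R : rat))
            ((#|F|%:R : rat) ^- M).

(* Main.v *)
Require Import Defs.
From HB Require Import structures.
From mathcomp Require Import all_boot all_order all_algebra all_field.
From mathcomp Require Import finmap.
From mathcomp Require Import ring zify.
From Stdlib Require Import ClassicalEpsilon FunctionalExtensionality.
Import Order.TTheory GRing.Theory Num.Theory.
Local Open Scope ring_scope.
Set Implicit Arguments. Unset Strict Implicit. Unset Printing Implicit Defensive.

(* By Weyl's criterion it suffices that e(f(u)) averages to 0 along every Folner
   sequence, where f(u) = sum_s lambda_s(u^s) for additive functionals lambda_s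
   from F_q[t] to F_p.  In characteristic p the functionals at s, p s, p^2 s, ...
   all act on the single monomial u^s, so they are first merged into one
   functional a_s for each s not divisible by p; conditions (i) and (ii) say that
   a_l = lambda_l is left untouched.  Call a_s rational when it vanishes on a
   nonzero ideal (g).  Differencing with shifts in (g), for a common g, kills all
   rational terms.  Expanding exponents in base p, u^s is a product of additive
   maps u_j^(p^e), hence a polynomial map whose degree is the number of base-p
   digits counted with multiplicity.  Van der Corput differencing reduces the
   claim to showing that the multilinear form attached to the terms of top degree
   among the irrational ones does not degenerate on subgroups of finite index.
   Multiplying its arguments by fixed polynomials separates the different products
   of additive maps (they are Frobenius twists of one another only if they
   coincide), and a single product degenerates only if its functional is rational. *)

(** * Averages along Folner sequences *)

Definition null_seq (x : nat -> algC) : Prop :=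
  forall eps : rat, 0 < eps ->
  exists N0 : nat, forall N, (N0 <= N)%N -> `|x N| <= ratr eps.

Lemma null_seq_le (x y : nat -> algC) :
  (forall N, `|x N| <= `|y N|) -> null_seq y -> null_seq x.
Proof.
move=> le_xy ny eps /ny[N0 hN]; exists N0 => N /hN; exact: le_trans (le_xy N).
Qed.

Lemma null_seqD (x y : nat -> algC) :
  null_seq x -> null_seq y -> null_seq (fun N => x N + y N).
Proof.
move=> nx ny eps eps0; have eps2 : 0 < eps / 2%:R by rewrite divr_gt0.
have [[N1 h1] [N2 h2]] := (nx _ eps2, ny _ eps2).
exists (maxn N1 N2) => N; rewrite geq_max => /andP[/h1 l1 /h2 l2].
apply: le_trans (ler_normD _ _) _; apply: le_trans (lerD l1 l2) _.
by rewrite -rmorphD /= -mulr2n -(mulr_natr (eps / _)) mulfVK.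
Qed.

Lemma null_seqZ (c : algC) (x : nat -> algC) :
  null_seq x -> null_seq (fun N => c * x N).
Proof.
move=> nx eps eps0; pose b := (Num.Def.archi_bound `|c|).+1.
have b0 : (0 : rat) < b%:R by rewrite ltr0n.
have [N0 hN] := nx _ (divr_gt0 eps0 b0); exists N0 => N /hN le_x.
have cb : `|c| <= b%:R.
  apply: ltW; apply: lt_le_trans (archi_boundP (normr_ge0 c)) _.
  by rewrite ler_nat.
rewrite normrM; apply: le_trans (ler_pM _ _ cb le_x) _ => //.
by rewrite -(ratr_nat _ b) -rmorphM /= mulrCA mulfV ?mulr1 // gt_eqF.
Qed.

Lemma null_seq_sum (I : Type) (r : seq I) (P : pred I) (x : I -> nat -> algC) :
  (forall i, P i -> null_seq (x i)) ->
  null_seq (fun N => \sum_(i <- r | P i) x i N).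
Proof.
move=> nx; elim: r => [|i r IH].
  move=> eps eps0; exists 0%N => N _; rewrite big_nil normr0.
  by rewrite ler0q ltW.
case Pi: (P i); last first.
  by apply: null_seq_le IH => N; rewrite big_cons Pi.
apply: null_seq_le (null_seqD (nx i Pi) IH) => N.
by rewrite big_cons Pi.
Qed.

Section Averages.
Variables (F : finFieldType) (d : nat).
Local Notation V := {ffun 'I_d -> {poly F}}.
Implicit Types (A B : {fset V}) (g : V -> algC).

Definition avg A g : algC := (\sum_(u <- A) g u) / #|` A|%:R.

Lemma avgD A g1 g2 : avg A (fun u => g1 u + g2 u) = avg A g1 + avg A g2.
Proof. by rewrite /avg big_split mulrDl. Qed.

Lemma avgZ A c g : avg A (fun u => c * g u) = c * avg A g.
Proof. by rewrite /avg -mulr_sumr mulrA. Qed.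

Lemma avg_sum A (I : Type) (r : seq I) (P : pred I) (G : I -> V -> algC) :
  avg A (fun u => \sum_(i <- r | P i) G i u) = \sum_(i <- r | P i) avg A (G i).
Proof. by rewrite /avg exchange_big mulr_suml. Qed.

Lemma eq_avg A g1 g2 : g1 =1 g2 -> avg A g1 = avg A g2.
Proof. by move=> e; rewrite /avg (eq_bigr g2). Qed.

Lemma avg_cst A c : (A != fset0)%fset -> avg A (fun=> c) = c.
Proof.
rewrite -cardfs_gt0 => A0.
rewrite /avg big_const_seq count_predT iter_addr addr0 -(mulr_natr c) mulfK //.
by rewrite pnatr_eq0 -lt0n.
Qed.

Lemma le_avg A g1 g2 : (forall u, g1 u <= g2 u) -> avg A g1 <= avg A g2.
Proof.
by move=> le12; rewrite ler_wpM2r ?invr_ge0 ?ler0n // ler_sum.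
Qed.

Lemma norm_avg A g : `|avg A g| <= avg A (fun u => `|g u|).
Proof.
rewrite normrM normfV normr_nat ler_wpM2r ?invr_ge0 ?ler0n //.
exact: ler_norm_sum.
Qed.

Lemma card_ftranslate A v : #|` ftranslate A v| = #|` A|.
Proof. by rewrite card_imfset //=; apply: addIr. Qed.

Lemma sum_ftranslate A v g :
  \sum_(u <- ftranslate A v) g u = \sum_(u <- A) g (u + v).
Proof. by rewrite big_imfset //= => x y _ _; apply: addIr. Qed.

Lemma sum_fsetI A B g :
  (forall u, `|g u| <= 1) ->
  `|\sum_(u <- A) g u - \sum_(u <- (A `&` B)%fset) g u|
     <= #|` A|%:R - #|` (A `&` B)%fset|%:R.
Proof.
move=> g1; rewrite (big_fsetID _ (mem B)) /=.
have -> : [fset x in A | x \in B]%fset = (A `&` B)%fset.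
  by apply/fsetP => x; rewrite !inE.
have -> : [fset x in A | x \notin B]%fset = (A `\` B)%fset.
  by apply/fsetP => x; rewrite !inE andbC.
rewrite addrAC subrr add0r -natrB ?fsubset_leq_card ?fsubsetIl // -cardfsD.
apply: le_trans (ler_norm_sum _ _ _) _.
apply: le_trans (ler_sum _ (fun u _ => g1 u)) _.
by rewrite big_const_seq count_predT iter_addr addr0.
Qed.

(** Both sums are compared with the sum over the intersection of [A] with its translate; each
    comparison discards only points outside it. *)
Lemma avg_shift A v g : (A != fset0)%fset ->
  (forall u, `|g u| <= 1) ->
  `|avg A (fun u => g (u + v)) - avg A g| <=
     2%:R * (1 - #|` (A `&` ftranslate A v)%fset|%:R / #|` A|%:R).
Proof.
rewrite -cardfs_gt0 => A0 g1; have A0' : 0 < #|` A|%:R :> algC by rewrite ltr0n.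
rewrite /avg -mulrBl normrM normfV normr_nat ler_pdivrMr //.
rewrite -mulrA mulrBl mul1r mulfVK ?gt_eqF //.
rewrite -sum_ftranslate mulr_natl mulr2n.
set S := \sum_(u <- (A `&` ftranslate A v)%fset) g u.
rewrite -[X in X - _](subrK S) -addrA; apply: le_trans (ler_normD _ _) _.
apply: lerD; last by rewrite distrC; apply: sum_fsetI.
by rewrite /S fsetIC -(card_ftranslate A v); apply: sum_fsetI.
Qed.

Variable Fo : nat -> {fset V}.
Hypothesis hFo : folner Fo.

Definition negligible g : Prop := null_seq (fun N => avg (Fo N) g).

Lemma null_shift v g : (forall u, `|g u| <= 1) ->
  null_seq (fun N => avg (Fo N) (fun u => g (u + v)) - avg (Fo N) g).
Proof.
move=> g1 eps eps0; have [Fo0 FoV] := hFo.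
have eps2 : 0 < eps / 2%:R by rewrite divr_gt0.
have [N0 hN] := FoV v _ eps2; exists N0 => N /hN lt_eps.
apply: le_trans (avg_shift v (Fo0 N) g1) _.
set m := #|` _|; set k := #|` _|.
have -> : 2%:R * (1 - m%:R / k%:R) = ratr (2%:R * (1 - m%:R / k%:R)) :> algC.
  by rewrite rmorphM rmorphB fmorph_div /= !ratr_nat rmorph1.
rewrite ler_rat mulrC -ler_pdivlMr //.
by apply: le_trans (ltW lt_eps); rewrite distrC ler_norm.
Qed.

(* van der Corput: [G] sums [n * n] translates of [g], and averaging
   [|G| <= (|G|^2 / n + n) / 2] replaces the Cauchy-Schwarz inequality. *)
Lemma van_der_corput g :
  (forall u, `|g u| = 1) ->
  (forall n : nat, exists h : 'I_n -> V, forall i j, i != j ->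
     negligible (fun u => g (u + h i) * (g (u + h j))^*)) ->
  negligible g.
Proof.
move=> g1 corr eps eps0.
(* [n] anticipates the final bound: the average will have modulus at most [3 / n]. *)
have [n n0 le_n] : exists2 n : nat, (0 < n)%N & 3%:R / n%:R <= eps.
  pose n := (Num.Def.archi_bound (3%:R / eps)).+1; exists n => //.
  have n0 : (0 : rat) < n%:R by rewrite ltr0n.
  rewrite ler_pdivrMr // mulrC -ler_pdivrMr //.
  have /archi_boundP/ltW le3 : 0 <= 3%:R / eps by rewrite divr_ge0 ?ltW.
  by apply: le_trans le3 _; rewrite ler_nat.
have [h hcorr] := corr (n * n)%N.
pose G u := \sum_i g (u + h i).
have nz1 : null_seq (fun N => \sum_(i < n * n)
   (avg (Fo N) (fun u => g (u + h i)) - avg (Fo N) g)).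
  by apply: null_seq_sum => i _; apply: null_shift => u; rewrite g1.
have nz2 : null_seq (fun N => \sum_(ij : 'I_(n * n) * 'I_(n * n) | ij.1 != ij.2)
   avg (Fo N) (fun u => g (u + h ij.1) * (g (u + h ij.2))^*)).
  by apply: null_seq_sum => ij; apply: hcorr.
have [[N1 h1] [N2 h2]] := (nz1 1 ltr01, nz2 1 ltr01).
exists (maxn N1 N2) => N; rewrite geq_max => /andP[/h1 + /h2 +].
set A := Fo N; have A0 : (A != fset0)%fset by apply: hFo.1.
rewrite rmorph1 => l1 l2.
have {l1} l1 : n%:R * n%:R * `|avg A g| <= `|avg A G| + 1.
  rewrite -natrM -[X in X * _]normr_nat -normrM.
  have -> : (n * n)%:R * avg A g = avg A G -
     \sum_(i < n * n) (avg A (fun u => g (u + h i)) - avg A g).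
    by rewrite sumrB -avg_sum subKr sumr_const card_ord mulr_natl.
  by apply: le_trans (ler_normB _ _) _; rewrite lerD2l.
(* The [n * n] diagonal pairs contribute 1 each; the off-diagonal correlations are null and together
   bounded by 1. *)
have GG : avg A (fun u => `|G u| ^+ 2) <= n%:R * n%:R + 1.
  have GE : avg A (fun u => `|G u| ^+ 2) = n%:R * n%:R +
     avg A (fun u => \sum_(ij : 'I_(n * n) * 'I_(n * n) | ij.1 != ij.2)
        g (u + h ij.1) * (g (u + h ij.2))^*).
    rewrite -[n%:R * n%:R](avg_cst _ A0) -avgD; apply: eq_avg => u.
    rewrite normCK /G rmorph_sum big_distrlr /=.
    rewrite pair_big /= (bigID (fun ij => ij.1 == ij.2)) /=; congr (_ + _).
    rewrite (eq_bigr (fun=> 1)); last first.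
      by case=> i j /= /eqP->; rewrite -normCK g1 expr1n.
    rewrite sumr_const -natrM; congr (_%:R).
    rewrite -[RHS]card_ord -(card_codom (f := fun i : 'I_(n * n) => (i, i))).
      apply: eq_card => -[i j]; apply/idP/codomP.
        by move=> e; exists j; congr (_, _); apply: (@eqP _ i j e).
      by case=> k [-> ->]; apply: eqxx.
    by move=> i j [].
  have GG0 : 0 <= avg A (fun u => `|G u| ^+ 2).
    by rewrite divr_ge0 ?ler0n // sumr_ge0 // => u _; rewrite exprn_ge0.
  rewrite -[leLHS]ger0_norm // GE; apply: le_trans (ler_normD _ _) _.
  by rewrite -natrM normr_nat lerD2l avg_sum.
have n0' : 0 < n%:R :> algC by rewrite ltr0n.
have n1 : 1 <= n%:R :> algC by rewrite ler1n.
have l3 : 2%:R * n%:R * `|avg A G| <= n%:R * n%:R + 1 + n%:R * n%:R.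
  apply: le_trans (ler_wpM2l _ (norm_avg _ _)) _; first by rewrite mulr_ge0 // ltW.
  rewrite -avgZ; apply: le_trans (lerD GG (lexx (n%:R * n%:R))).
  rewrite -[X in _ + X](avg_cst (n%:R * n%:R) A0) -avgD; apply: le_avg => u.
  rewrite -subr_ge0.
  have -> : `|G u| ^+ 2 + n%:R * n%:R - 2%:R * n%:R * `|G u| =
     (`|G u| - n%:R) ^+ 2 by rewrite sqrrB !expr2 mulr_natl; ring.
  by rewrite real_exprn_even_ge0 // rpredB ?normr_real ?realn.
have l4 : `|avg A G| <= n%:R + 1.
  rewrite -(ler_pM2l (_ : 0 < 2%:R * n%:R)) ?mulr_gt0 //.
  apply: le_trans l3 _; rewrite -subr_ge0.
  have -> : 2%:R * n%:R * (n%:R + 1) - (n%:R * n%:R + 1 + n%:R * n%:R) =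
     n%:R + (n%:R - 1) :> algC by ring.
  by rewrite addr_ge0 ?subr_ge0 ?ler0n.
have l5 : n%:R * `|avg A g| <= 3%:R.
  rewrite -(ler_pM2l n0') mulrA; apply: le_trans l1 _.
  apply: le_trans (lerD l4 (lexx 1)) _; rewrite -subr_ge0.
  have -> : n%:R * 3%:R - (n%:R + 1 + 1) = (n%:R - 1) + (n%:R - 1) :> algC.
    by ring.
  by rewrite addr_ge0 ?subr_ge0.
have : ratr (3%:R / n%:R) <= ratr eps :> algC by rewrite ler_rat.
by apply: le_trans; rewrite fmorph_div /= !ratr_nat ler_pdivlMr // mulrC.
Qed.
End Averages.

(** * Iterated differences and forms of finite rank *)

Section Differences.
Variables V T : zmodType.
Implicit Types (f : V -> T) (h u : V) (l : seq V).

Definition diff h f u := f (u + h) - f u.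

Fixpoint diffs l f := if l is h :: l' then diffs l' (diff h f) else f.

Lemma eq_diffs l f f' : f =1 f' -> diffs l f =1 diffs l f'.
Proof.
elim: l f f' => [|h l IH] f f' e //=; apply: IH => u.
by rewrite /diff !e.
Qed.

Lemma diffC h k f : diff h (diff k f) =1 diff k (diff h f).
Proof.
move=> u; rewrite /diff (addrAC u h k) !opprB addrACA.
by rewrite [RHS]addrACA (addrC (- _)).
Qed.

Lemma diffs_cons h l f : diffs (h :: l) f =1 diff h (diffs l f).
Proof.
elim: l f => [|k l IH] f u //=; rewrite -IH /=.
exact/eq_diffs/diffC.
Qed.

Lemma diffsCA h k l f : diffs (h :: k :: l) f =1 diffs (k :: h :: l) f.
Proof. exact: eq_diffs (diffC k h f). Qed.

Lemma diffsD l f1 f2 u :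
  diffs l (fun u => f1 u + f2 u) u = diffs l f1 u + diffs l f2 u.
Proof.
elim: l u => [|h l IH] u //; rewrite !diffs_cons /diff !IH.
by rewrite opprD addrACA.
Qed.

Lemma diffs_sum (I : Type) (r : seq I) (P : pred I) (G : I -> V -> T) l u :
  diffs l (fun u => \sum_(i <- r | P i) G i u) u =
  \sum_(i <- r | P i) diffs l (G i) u.
Proof.
elim: l u => [|h l IH] u //; rewrite diffs_cons /diff !IH -sumrB.
by apply: eq_bigr => i _; rewrite diffs_cons.
Qed.

(** Offset by one: [degree_lt 0] leaves only the zero map, [degree_lt 1] the constants. *)
Definition degree_lt n f : Prop := forall l u, size l = n -> diffs l f u = 0.

Lemma degree_lt_diff n f h : degree_lt n.+1 f -> degree_lt n (diff h f).
Proof. by move=> df l u sl; apply: (df (h :: l)); rewrite /= sl. Qed.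

Lemma degree_ltS n f : degree_lt n f -> degree_lt n.+1 f.
Proof. by move=> df [|h l] u // [sl]; rewrite diffs_cons /diff !df ?subrr. Qed.

Lemma degree_ltW m n f : (m <= n)%N -> degree_lt m f -> degree_lt n f.
Proof. by move/subnK <-; elim: (n - m)%N => //= k IH /IH; apply: degree_ltS. Qed.

Lemma degree_lt_cst n l f u : degree_lt n.+1 f -> size l = n ->
  diffs l f u = diffs l f 0.
Proof.
move=> df sl; apply/eqP; rewrite -subr_eq0 -[u in diffs l f u]add0r.
by rewrite -/(diff u (diffs l f) 0) -diffs_cons df //= sl.
Qed.

(* [L x l] is multilinear in the entries of [x :: l]; it has finite rank when,
   peeling off the arguments of [l] one after the other, each may be restricted
   to a subgroup of finite index so that in the end [L] vanishes.  The index
   condition is encoded by a finite colouring whose classes have differences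
   in the subgroup, so that no quotient is needed. *)
Fixpoint finite_rank m (L : V -> seq V -> T) : Prop :=
  if m is m'.+1 then
    exists (I : finType) (chi : V -> I), forall h h', chi h = chi h' ->
      finite_rank m' (fun x l => L x (h - h' :: l))
  else forall x, L x [::] = 0.

Implicit Type L : V -> seq V -> T.

Lemma eq_finite_rank m L L' :
  (forall x l, size l = m -> L x l = L' x l) ->
  finite_rank m L -> finite_rank m L'.
Proof.
elim: m L L' => [|m IH] L L' e /=; first by move=> L0 x; rewrite -e.
move=> [I [chi hchi]]; exists I, chi => h h' /hchi.
by apply: IH => x l sl; rewrite e //= sl.
Qed.

Lemma finite_rankB m L L' : finite_rank m L -> finite_rank m L' ->
  finite_rank m (fun x l => L x l - L' x l).
Proof.
elim: m L L' => [|m IH] L L' /=; first by move=> L0 L'0 x; rewrite L0 L'0 subrr.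
move=> [I [chi hchi]] [I' [chi' hchi']].
exists (I * I')%type, (fun h => (chi h, chi' h)) => h h' [e e'].
exact: IH (hchi _ _ e) (hchi' _ _ e').
Qed.

Lemma finite_rankN m L : finite_rank m L -> finite_rank m (fun x l => - L x l).
Proof.
elim: m L => [|m IH] L /=; first by move=> L0 x; rewrite L0 oppr0.
move=> [I [chi hchi]]; exists I, chi => h h' /hchi; exact: IH.
Qed.

(** The colouring of each argument is pulled back along its own additive map [psi i]. The first
    argument is never coloured, so any [phi] will do. *)
Lemma finite_rank_comp (phi : V -> V) (psi : nat -> V -> V) m L :
  (forall i, {morph psi i : h h' / h - h'}) ->
  finite_rank m L ->
  finite_rank m (fun x l => L (phi x) [seq psi ih.1 ih.2 | ih <- zip (iota 0 (size l)) l]).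
Proof.
have shift (p : nat -> V -> V) n k (l : seq V) :
    [seq p ih.1 ih.2 | ih <- zip (iota n.+1 k) l] =
    [seq p ih.1.+1 ih.2 | ih <- zip (iota n k) l].
  by elim: k n l => [|k IHk] n [|h l] //=; rewrite IHk.
elim: m psi L => [|m IH] psi L psiB /=; first by move=> L0 x.
move=> [I [chi hchi]]; exists I, (fun h => chi (psi 0%N h)) => h h' /hchi.
rewrite -psiB => /(IH (fun i => psi i.+1)).
move=> /(_ (fun i => psiB i.+1)); apply: eq_finite_rank => x l sl.
by rewrite shift.
Qed.

(** Greedy choice: if a family of [n] points cannot be extended, every [w] differs from some [h i]
    by a direction of finite rank. Colouring [w] by such an [i] gives finite rank to differences
    within a colour, against the hypothesis. *)
Lemma not_finite_rank m L :
  (forall x a b l, size l = m -> L x (a - b :: l) = L x (a :: l) - L x (b :: l)) ->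
  ~ finite_rank m.+1 L ->
  forall n, exists h : 'I_n -> V, forall i j, i != j ->
    ~ finite_rank m (fun x l => L x (h i - h j :: l)).
Proof.
move=> LB nfr.
have sym a b : finite_rank m (fun x l => L x (a - b :: l)) ->
               finite_rank m (fun x l => L x (b - a :: l)).
  move=> /finite_rankN; apply: eq_finite_rank => x l sl.
  by rewrite !LB // opprB.
suff wit n : exists h : nat -> V, forall i j, (i < j < n)%N ->
    ~ finite_rank m (fun x l => L x (h i - h j :: l)).
  move=> n; have [h hh] := wit n; exists h => i j; rewrite neq_ltn.
  case/orP=> ij; first by apply: hh; rewrite ij ltn_ord.
  by move=> /sym; apply: hh; rewrite ij ltn_ord.
elim: n => [|n [h hh]]; first by exists (fun=> 0) => i j; rewrite andbF.
apply: NNPP => nex; apply: nfr.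
have cl w : exists i : 'I_n, finite_rank m (fun x l => L x (h i - w :: l)).
  apply: NNPP => nw; apply: nex; exists (fun i => if i == n then w else h i).
  move=> i j /andP[ij]; rewrite ltnS leq_eqVlt => /orP[/eqP jn|jn].
    rewrite jn in ij *; rewrite (ltn_eqF ij) eqxx => fr; apply: nw.
    by exists (Ordinal ij).
  by rewrite (ltn_eqF jn) (ltn_eqF (ltn_trans ij jn)); apply: hh; rewrite ij.
pose chi w := proj1_sig (constructive_indefinite_description _ (cl w)).
exists 'I_n, chi => a b ab.
have fa : finite_rank m (fun x l => L x (h (chi a) - a :: l)).
  exact: proj2_sig (constructive_indefinite_description _ (cl a)).
have fb : finite_rank m (fun x l => L x (h (chi b) - b :: l)).
  exact: proj2_sig (constructive_indefinite_description _ (cl b)).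
rewrite ab in fa; apply: eq_finite_rank (finite_rankB fb fa) => x l sl.
by rewrite !LB // opprB addrC addrA subrK.
Qed.
End Differences.

(** * Negligibility of polynomial phases *)

Section PolynomialPhases.
Variables (F : finFieldType) (d : nat).
Local Notation V := {ffun 'I_d -> {poly F}}.
Variable Fo : nat -> {fset V}.
Hypothesis hFo : folner Fo.
Variables (T : zmodType) (e : T -> algC).
Hypothesis eD : {morph e : x y / x + y >-> x * y}.
Hypothesis e_norm : forall x, `|e x| = 1.
Hypothesis e_inj : forall x, e x = 1 -> x = 0.

Let eB x y : e (x - y) = e x * (e y)^*.
Proof.
have ey : e y * (e y)^* = 1 by rewrite -normCK e_norm expr1n.
by rewrite -[in RHS](subrK y x) eD -mulrA ey mulr1.
Qed.

Lemma negligible_shift v g : (forall u, `|g u| <= 1) ->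
  negligible Fo g -> negligible Fo (fun u => g (u + v)).
Proof.
move=> g1 ng; apply: null_seq_le (null_seqD (null_shift hFo v g1) ng) => N.
by rewrite subrK.
Qed.

(* [f'] is the polynomial part of [f] seen by the differences along [phi]; [f] may
   contain further [phi]-periodic terms. *)
Lemma negligible_phase (phi : V -> V) :
  {morph phi : h h' / h - h'} ->
  forall m (f f' : V -> T),
  (forall h, diff (phi h) f =1 diff (phi h) f') ->
  degree_lt m.+2 f' ->
  ~ finite_rank m (fun x l => diffs (map phi (x :: l)) f' 0) ->
  negligible Fo (fun u => e (f u)).
Proof.
move=> phiB; elim=> [|m IH] f f' eff df nfr.
  (* Here [f'] is affine: translation by [phi x] multiplies the average by a constant other than 1,
     while changing it by a null sequence. *)
  have [x nx] : exists x, diff (phi x) f' 0 <> 0.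
    apply: NNPP => nex; apply: nfr => x /=; apply: NNPP => nx.
    by apply: nex; exists x.
  set c := diff (phi x) f' 0 in nx.
  have ec : e c - 1 != 0.
    by rewrite subr_eq0; apply/eqP => /e_inj.
  have g1 u : `|e (f u)| <= 1 by rewrite e_norm.
  apply: null_seq_le (null_seqZ (e c - 1)^-1 (null_shift hFo (phi x) g1)) => N.
  have -> : avg (Fo N) (fun u => e (f (u + phi x))) =
            e c * avg (Fo N) (fun u => e (f u)).
    rewrite -avgZ; apply: eq_avg => u.
    rewrite -[f _](subrK (f u)) eD -/(diff (phi x) f u) eff.
    by rewrite -/(diffs [:: phi x] f' u) (degree_lt_cst _ df).
  by rewrite -[X in _ * (_ - X)]mul1r -mulrBl mulKf.
apply: van_der_corput => // n.
pose L x l := diffs (map phi (x :: l)) f' 0.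
have LB x a b l : size l = m -> L x (a - b :: l) = L x (a :: l) - L x (b :: l).
  move=> sl; rewrite /L !map_cons !(diffsCA (phi x)) phiB !diffs_cons.
  rewrite -!diffs_cons.
  (* After these [m.+1] differences an affine map remains, whose increments do not depend on the
     base point. *)
  have Gc u v : diff u (diffs (phi x :: map phi l) f') v =
                diff u (diffs (phi x :: map phi l) f') 0.
    by rewrite -!diffs_cons (degree_lt_cst _ df) //= size_map sl.
  rewrite !diffs_cons -(Gc _ (phi b)) /diff add0r subrKC opprB addrA subrK.
  by rewrite !add0r.
have [h hh] := not_finite_rank LB nfr n.
exists (fun i => phi (h i)) => i j ij.
(* Differencing removes the periodic terms, so [f2] now serves both as the phase and as its
   polynomial part. *)
pose f2 := diff (phi (h i - h j)) f'.
apply: null_seq_le (_ : negligible Fo (fun u => e (f2 (u + phi (h j))))) => [N|].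
  rewrite (eq_avg _ (g2 := fun u => e (f2 (u + phi (h j))))) // => u.
  by rewrite /f2 -eff /diff phiB addrACA subrr addr0 eB.
apply: (@negligible_shift _ (fun u => e (f2 u))) => [u|].
  by rewrite e_norm.
apply: (IH f2 f2) => //; first exact: degree_lt_diff.
move=> fr; apply: (hh i j ij); apply: eq_finite_rank fr => x l sl.
by rewrite /L map_cons -diffsCA.
Qed.
End PolynomialPhases.

(** * Products of Frobenius twists *)

Section Additive.
Variables (U T : zmodType) (a : U -> T).
Hypothesis aB : {morph a : y z / y - z}.

Lemma additive0 : a 0 = 0.
Proof. by have := aB 0 0; rewrite !subrr. Qed.

Lemma additiveD : {morph a : y z / y + z}.
Proof.
move=> y z; rewrite -[z in LHS]opprK aB.
by rewrite -[- z]add0r aB additive0 sub0r opprK.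
Qed.

Lemma additive_sum (I : Type) (r : seq I) (P : pred I) G :
  a (\sum_(i <- r | P i) G i) = \sum_(i <- r | P i) a (G i).
Proof. exact: (big_morph a additiveD additive0). Qed.
End Additive.

Lemma degree_ltD (V T : zmodType) n (f f' : V -> T) :
  degree_lt n f -> degree_lt n f' -> degree_lt n (fun u => f u + f' u).
Proof. by move=> df df' l u sl; rewrite diffsD df ?df' ?addr0. Qed.

Lemma eq_degree_lt (V T : zmodType) n (f f' : V -> T) :
  f =1 f' -> degree_lt n f -> degree_lt n f'.
Proof. by move=> e df l u sl; rewrite -(eq_diffs l e) df. Qed.

Lemma diffs_comp (V T T' : zmodType) (a : T -> T') (f : V -> T) l u :
  {morph a : x y / x - y} -> diffs l (fun u => a (f u)) u = a (diffs l f u).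
Proof.
by move=> aB; elim: l u => [|h l IH] u //; rewrite !diffs_cons /diff !IH aB.
Qed.

Lemma degree_lt_comp (V T T' : zmodType) (a : T -> T') n (f : V -> T) :
  {morph a : x y / x - y} -> degree_lt n f -> degree_lt n (fun u => a (f u)).
Proof.
move=> aB df l u sl; by rewrite diffs_comp // df // additive0.
Qed.

(** Leibniz rule: the difference of [x * f] along [h] is [x * diff h f] plus terms with the constant
    factor [x h], so induction on [n] applies. *)
Lemma degree_lt_mul (V : zmodType) (R : comPzRingType) (x f : V -> R) n :
  {morph x : u v / u + v} -> degree_lt n f ->
  degree_lt n.+1 (fun u => x u * f u).
Proof.
move=> xD; elim: n f => [|n IH] f df.
  apply: degree_ltS => -[] //= u _.
  by rewrite -[f u]/(diffs [::] f u) df ?mulr0.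
case=> // h l u [sl].
have e : (fun u => (x h * f u + x h * diff h f u) + x u * diff h f u) =1
         diff h (fun u => x u * f u).
  by move=> v; rewrite /diff xD; ring.
suff D : degree_lt n.+1 (diff h (fun u => x u * f u)) by apply: D.
apply: (eq_degree_lt e).
have cB c : {morph (fun y : R => c * y) : y z / y - z} by move=> y z; apply: mulrBr.
apply: degree_ltD; last exact: IH (degree_lt_diff h df).
apply: degree_ltD; first exact: (degree_lt_comp (cB (x h)) df).
exact: (degree_lt_comp (cB (x h)) (degree_ltS (degree_lt_diff h df))).
Qed.

Section Slots.
Variables (F : finFieldType) (p d : nat).
Hypothesis hp : p \in [pchar F].
Local Notation Z := {poly F}.
Local Notation V := {ffun 'I_d -> Z}.
Local Notation slot := ('I_d * nat)%type.
Implicit Types (x : slot) (c : seq slot) (u h : V) (l : seq V).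

(* The slot [(j, e)] stands for the additive map [u |-> u_j ^ (p ^ e)]. *)
Definition slot_val x u : Z := u x.1 ^+ (p ^ x.2).

Lemma slot_valD x : {morph slot_val x : u v / u + v}.
Proof.
have pP : p \in [pchar Z] by rewrite pchar_poly.
move=> u v; rewrite /slot_val ffunE; elim: (x.2) => [|e IH]; first by rewrite !expr1.
by rewrite expnSr !exprM IH -!(pFrobenius_autE pP) pFrobenius_autD_comm //; apply: mulrC.
Qed.

Definition slot_mon c u : Z := \prod_(x <- c) slot_val x u.
Definition slot_form c l : Z := \prod_(xh <- zip c l) slot_val xh.1 xh.2.

Lemma slot_mon_cons x c u : slot_mon (x :: c) u = slot_val x u * slot_mon c u.
Proof. exact: big_cons. Qed.

Lemma slot_form_cons x c h l :
  slot_form (x :: c) (h :: l) = slot_val x h * slot_form c l.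
Proof. exact: big_cons. Qed.

Lemma slot_mon_perm c c' : perm_eq c c' -> slot_mon c =1 slot_mon c'.
Proof. by move=> pc u; apply: perm_big. Qed.

Lemma degree_lt_slot_mon c : degree_lt (size c).+1 (slot_mon c).
Proof.
elim: c => [|x c IH].
  by move=> [|h [|]] // u _; rewrite /= /diff /slot_mon !big_nil subrr.
apply: eq_degree_lt (degree_lt_mul (slot_valD x) IH) => u.
by rewrite slot_mon_cons.
Qed.

(** Product rule: the neglected terms use the increments of at least two factors, hence lose two
    degrees. *)
Lemma diff_slot_mon c h :
  degree_lt (size c).-1 (fun u => diff h (slot_mon c) u -
     \sum_(x <- c) slot_val x h * slot_mon (rem x c) u).
Proof.
elim: c => [|x c IH].
  by move=> [] // u _; rewrite /= big_nil /diff /slot_mon !big_nil !subrr.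
have e : (fun u => slot_val x h * diff h (slot_mon c) u + slot_val x u *
             (diff h (slot_mon c) u - \sum_(y <- c) slot_val y h * slot_mon (rem y c) u)) =1
   (fun u => diff h (slot_mon (x :: c)) u -
     \sum_(y <- x :: c) slot_val y h * slot_mon (rem y (x :: c)) u).
  move=> u; rewrite big_cons [rem x _]/= eqxx.
  have -> : \sum_(y <- c) slot_val y h * slot_mon (rem y (x :: c)) u =
            slot_val x u * \sum_(y <- c) slot_val y h * slot_mon (rem y c) u.
    rewrite mulr_sumr; apply: eq_big_seq => y yc.
    rewrite mulrCA -slot_mon_cons; congr (_ * _); apply: slot_mon_perm.
    rewrite -(perm_cons y); apply: (@perm_trans _ (x :: c)).
      by rewrite perm_sym perm_to_rem // inE yc orbT.
    rewrite perm_sym -[[:: y, x & _]]/([:: y] ++ [:: x] ++ rem y c) perm_catCA /=.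
    by rewrite perm_cons perm_sym perm_to_rem.
  by rewrite /diff !slot_mon_cons slot_valD; ring.
apply: (eq_degree_lt e); apply: degree_ltD.
  apply: degree_lt_comp; first by move=> y z; apply: mulrBr.
  exact/degree_lt_diff/degree_lt_slot_mon.
(* For a single slot the error must vanish identically, while [degree_lt_mul] would only make it
   constant. *)
case: c IH {e} => [|y c] IH; last exact: degree_lt_mul (slot_valD x) IH.
by move=> [] // u _; rewrite /= big_nil /diff /slot_mon !big_nil !subrr mulr0.
Qed.

(** Orderings are listed with multiplicity: when slots repeat, the same ordering appears once for
    each permutation producing it. *)
Fixpoint orderings n c : seq (seq slot) :=
  if n is n'.+1 then
    flatten [seq [seq x :: c' | c' <- orderings n' (rem x c)] | x <- c]
  else [:: [::]].

Lemma orderings_perm n c c' :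
  size c = n -> c' \in orderings n c -> perm_eq c' c.
Proof.
elim: n c c' => [|n IH] c c' /=; first by rewrite inE => /size0nil-> /eqP->.
move=> sc /flattenP[? /mapP[x xc ->] /mapP[c2 hc2 ->]].
rewrite perm_sym; apply: perm_trans (perm_to_rem xc) _; rewrite perm_cons perm_sym.
by apply: IH hc2; rewrite size_rem // sc.
Qed.

(** Polarization: each difference replaces one slot by its value at the shift, and the remaining
    [size l] differences annihilate the error of [diff_slot_mon]. *)
Lemma diffs_slot_mon c l u : size l = size c ->
  diffs l (slot_mon c) u = \sum_(c' <- orderings (size c) c) slot_form c' l.
Proof.
elim: l c u => [|h l IH] c u /=.
  move/esym/size0nil->; rewrite /= big_seq1 /slot_form /slot_mon !big_nil //.
move=> sc.
have := @diff_slot_mon c h l u; rewrite -sc => /(_ erefl)/eqP.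
rewrite diffsD (diffs_comp _ _ _ (a := -%R)); last first.
  by move=> y z; rewrite opprB opprK addrC.
rewrite subr_eq0 => /eqP->; rewrite diffs_sum big_flatten big_map.
apply: eq_big_seq => x xc; rewrite big_map.
rewrite diffs_comp; last by move=> y z; apply: mulrBr.
have sr : size l = size (rem x c) by rewrite size_rem // -sc.
rewrite IH // -sr mulr_sumr; apply: eq_bigr => c' _.
by rewrite slot_form_cons.
Qed.

(** The count is the product of the factorials of the slot multiplicities, all below [p]. Hence
    polarization does not lose this term in characteristic [p]. *)
Lemma count_orderings c c0 : prime p -> perm_eq c0 c ->
  (forall x, (count_mem x c < p)%N) ->
  ~~ (p %| count_mem c0 (orderings (size c) c))%N.
Proof.
move=> pp; elim: c0 c => [|x c0 IH] c.
  move=> /perm_size /esym/size0nil-> _ /=.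
  by rewrite gtnNdvd ?prime_gt1.
move=> pc cp; rewrite -(perm_size pc) /= count_flatten -!map_comp.
have xc : x \in c by rewrite -(perm_mem pc) mem_head.
have E (c1 : seq slot) : sumn [seq (count_mem (x :: c0) \o
      (fun x => [seq x :: c' | c' <- orderings (size c0) (rem x c)])) y | y <- c1] =
    (count_mem x c1 * count_mem c0 (orderings (size c0) (rem x c)))%N.
  elim: c1 => [|y c1 IHc] //=; rewrite IHc mulnDl; congr (_ + _)%N.
  rewrite count_map; case: eqP => [->|ne] /=.
    by rewrite mul1n; apply: eq_count => c2 /=; rewrite eqseq_cons eqxx.
  rewrite mul0n; apply/eqP; rewrite -leqn0 leqNgt -has_count -all_predC.
  by apply/allP => c2 _ /=; rewrite eqseq_cons; case: eqP.
rewrite {}E.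
have pr : perm_eq c0 (rem x c).
  by rewrite -(perm_cons x); apply: perm_trans pc (perm_to_rem xc).
rewrite Euclid_dvdM // negb_or; apply/andP; split.
  by rewrite gtnNdvd // -has_count has_pred1.
rewrite (perm_size pr); apply: IH => // y.
apply: leq_ltn_trans (cp y); rewrite (permP (perm_to_rem xc)) /=.
exact: leq_addl.
Qed.
End Slots.

(** * Separating products of Frobenius twists *)

Section Separation.
Variables (F : finFieldType) (p d : nat).
Hypothesis hp : p \in [pchar F].
Local Notation Z := {poly F}.
Local Notation V := {ffun 'I_d -> Z}.
Local Notation slot := ('I_d * nat)%type.
Implicit Types (x : slot) (c : seq slot) (u h : V) (l : seq V).
Local Notation slot_val := (slot_val p).
Local Notation slot_form := (slot_form p).

Let p_gt0 : (0 < p)%N.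
Proof. by rewrite prime_gt0 // (pcharf_prime hp). Qed.

Lemma slot_valM x u h : slot_val x (u * h) = slot_val x u * slot_val x h.
Proof. by rewrite /slot_val ffunE exprMn. Qed.

Lemma slot_form_mul (ms : seq V) c l : size c = size l ->
  slot_form c [seq nth 0 ms ih.1 * ih.2 | ih <- zip (iota 0 (size l)) l] =
  \prod_(xi <- zip c (iota 0 (size c))) slot_val xi.1 (nth 0 ms xi.2)
  * slot_form c l.
Proof.
move=> sc; rewrite /slot_form -sc.
elim: c l 0%N sc => [|x c IH] [|h l] //= n; first by rewrite !big_nil mulr1.
by case=> sc; rewrite !big_cons /= IH // slot_valM mulrACA.
Qed.

Variables (T : zmodType) (I : eqType) (r : seq I) (a : I -> Z -> T) (c : I -> seq slot).
Hypothesis aB : forall i, {morph a i : y z / y - z}.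
Variable m : nat.
Hypothesis sc : forall i, i \in r -> size (c i) = m.+1.

Definition weighted_form (Q : seq slot -> Z) (u : V) l : T :=
  \sum_(i <- r) a i (Q (c i) * slot_form (c i) (u :: l)).

(** Weights that can be created without losing finite rank; the aim is one that vanishes on an
    unwanted slot sequence. *)
Definition admissible (q : seq slot -> Z) := forall Q,
  finite_rank m (weighted_form Q) ->
  finite_rank m (weighted_form (fun c => q c * Q c)).

Definition slot_weight (ms : seq V) c : Z :=
  \prod_(xi <- zip c (iota 0 (size c))) slot_val xi.1 (nth 0 ms xi.2).

(** Multiplying the argument in position [i] by [nth 0 ms i] is an additive substitution, and slots
    are multiplicative. *)
Lemma admissible_weight (ms : seq V) : admissible (slot_weight ms).
Proof.
move=> Q /(finite_rank_comp (fun h => nth 0 ms 0 * h)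
   (psi := fun i h => nth 0 ms i.+1 * h)).
move=> /(_ (fun i h h' => mulrBr _ _ _)).
apply: eq_finite_rank => u l sl; apply: eq_big_seq => i ir.
rewrite -mulrA mulrCA -slot_form_mul; last by rewrite sc //= sl.
suff E k n l' : [seq nth 0 ms ih.1.+1 * ih.2 | ih <- zip (iota n k) l'] =
                [seq nth 0 ms ih.1 * ih.2 | ih <- zip (iota n.+1 k) l'].
  by rewrite E.
by elim: k n l' => [|k IH] n [|h l'] //=; rewrite IH.
Qed.

Lemma admissibleB q q' :
  admissible q -> admissible q' -> admissible (fun c => q c - q' c).
Proof.
move=> Aq Aq' Q fr; apply: eq_finite_rank (finite_rankB (Aq _ fr) (Aq' _ fr)).
move=> u l _; rewrite /weighted_form -sumrB; apply: eq_bigr => i _.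
by rewrite -aB -!mulrBl.
Qed.

Variables (j0 : 'I_d) (c1 : seq slot).
Let c0 := (j0, 0%N) :: c1.
Hypothesis sc1 : size c1 = m.

(** On products of slots this is the [v]-th iterate of Frobenius. *)
Definition shift_slots v (b : seq slot) : seq slot := [seq (x.1, (x.2 + v)%N) | x <- b].

Lemma slot_weight_nth ms (b : seq slot) : slot_weight ms b =
  \prod_(i < size b) slot_val (nth (j0, 0%N) b i) (nth 0 ms i).
Proof.
rewrite /slot_weight (big_nth (j0, 0%N, 0%N)) size_zip size_iota minnn big_mkord.
apply: eq_bigr => i _; rewrite nth_zip ?size_iota //= nth_iota //.
Qed.

(* If two slots sit in different components, evaluate at indicator vectors.
   Otherwise let [e_i] be the exponents of [b]: multiplying the argument in some
   position [i] by [X^(p^e_0)], or the one in position 0 by [X^(p^e_i)], has the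
   same effect on [b] but not on [c0]. *)
Lemma separate b : size b = m.+1 -> (forall v, b <> shift_slots v c0) ->
  exists q, [/\ admissible q, q b = 0 & q c0 != 0].
Proof.
move=> sb nb; have sc0 : size c0 = m.+1 by rewrite /= sc1.
pose x0 := (j0, 0%N).
have [/existsP[i ni]|/existsPn eqj] :=
    boolP [exists i : 'I_m.+1, (nth x0 b i).1 != (nth x0 c0 i).1].
  pose ms := [seq [ffun j => (j == x.1)%:R] : V | x <- c0].
  have msE k : (k < m.+1)%N -> nth 0 ms k = [ffun j => (j == (nth x0 c0 k).1)%:R].
    by move=> km; rewrite (nth_map x0) ?sc0.
  exists (slot_weight ms); split; first exact: admissible_weight.
    rewrite slot_weight_nth sb (bigD1 i) //= /slot_val msE // ffunE.
    by rewrite (negPf ni) expr0n expn_eq0 (gtn_eqF p_gt0) mul0r.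
  rewrite slot_weight_nth sc0 big1 ?oner_eq0 // => k _.
  by rewrite /slot_val msE // ffunE eqxx expr1n.
pose e' := (nth x0 b 0).2.
have [/existsP[i ni]|/existsPn eqe] :=
    boolP [exists i : 'I_m.+1, (nth x0 b i).2 != ((nth x0 c0 i).2 + e')%N].
  have i0 : 0%N != i :> nat.
    by apply: contra ni => /eqP<-; rewrite /= add0n.
  pose ms (k N : nat) := mkseq (fun n => [ffun=> if n == k then 'X^N else 1] : V) m.+1.
  have msE k N c2 : (k < m.+1)%N -> size c2 = m.+1 ->
      slot_weight (ms k N) c2 = 'X^(N * p ^ (nth x0 c2 k).2).
    move=> km szc; rewrite slot_weight_nth szc (bigD1 (Ordinal km)) //= big1.
      by rewrite mulr1 /slot_val nth_mkseq // ffunE eqxx exprM.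
    move=> k' /negPf nk; rewrite /slot_val nth_mkseq // ffunE.
    have -> : (k' == k :> nat) = false by exact: nk.
    by rewrite expr1n.
  exists (fun c => slot_weight (ms i (p ^ e')%N) c -
                   slot_weight (ms 0%N (p ^ (nth x0 b i).2)%N) c); split.
  - by apply: admissibleB; apply: admissible_weight.
  - by rewrite !msE // -/e' mulnC subrr.
  (* The first slot of [c0] has exponent 0, so equality would force the exponent of [b] in position
     [i] to be that of [c0] plus [e']. *)
  - rewrite !msE // subr_eq0 muln1 -expnD; apply/eqP.
    move=> /(congr1 (fun f : Z => size f)); rewrite !size_polyXn => -[].
    move/eqP; rewrite eqn_exp2l ?prime_gt1 ?(pcharf_prime hp) //.
    by rewrite eq_sym addnC (negPf ni).
case: (nb e'); apply: (@eq_from_nth _ x0) => [|i].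
  by rewrite size_map sb sc0.
rewrite sb => im; rewrite (nth_map x0) ?sc0 //.
have := eqe (Ordinal im); have := eqj (Ordinal im); rewrite !negbK /=.
by case: (nth x0 b i) => ? ? /= /eqP-> /eqP->.
Qed.

(** One separating weight for each slot sequence other than [c0] is multiplied into [Q]; the last
    hypothesis rules out the nontrivial twists of [c0], to which [separate] does not apply. *)
Lemma isolate Q : Q c0 != 0 -> finite_rank m (weighted_form Q) ->
  (forall i v, i \in r -> c i = shift_slots v c0 -> c i = c0) ->
  exists2 q, q != 0 &
    finite_rank m (fun u l => \sum_(i <- r | c i == c0) a i (q * slot_form c0 (u :: l))).
Proof.
move=> Q0 frQ nsh.
have r0 i : a i 0 = 0 := additive0 (aB i).
suff sel (r' : seq I) : {subset r' <= r} -> exists Q', [/\ Q' c0 != 0,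
    finite_rank m (weighted_form Q') &
    forall i, i \in r' -> c i != c0 -> Q' (c i) = 0].
  have [//|Q' [Q'0 frQ' Qr]] := sel r.
  exists (Q' c0) => //; apply: eq_finite_rank frQ' => u l _.
  rewrite /weighted_form (bigID (fun i => c i == c0)) /= [X in _ + X]big1_seq ?addr0.
    by apply: eq_bigr => i /eqP->.
  by move=> i /andP[ni ir]; rewrite Qr // mul0r r0.
elim: r' => [|i r' IH] sub; first by exists Q.
have [|Q' [Q'0 frQ' Qr]] := IH.
  by move=> j jr; apply: sub; rewrite inE jr orbT.
have ir : i \in r by apply: sub; rewrite mem_head.
have [ci|ni] := eqVneq (c i) c0.
  exists Q'; split=> // j; rewrite inE => /predU1P[->|]; last exact: Qr.
  by rewrite ci eqxx.
have [|q [Aq qb qc]] := separate (sc ir).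
  by move=> v /(nsh _ _ ir)/eqP; rewrite (negPf ni).
exists (fun c => q c * Q' c); split; first by rewrite mulf_neq0.
  exact: Aq.
move=> j; rewrite inE => /predU1P[->|jr nj]; first by rewrite qb mul0r.
by rewrite Qr // mulr0.
Qed.

End Separation.

Lemma degree_lt_sum (V T : zmodType) (I : eqType) (r : seq I) (P : pred I)
    (G : I -> V -> T) n :
  (forall i, i \in r -> P i -> degree_lt n (G i)) ->
  degree_lt n (fun u => \sum_(i <- r | P i) G i u).
Proof.
move=> dG l u sl; rewrite diffs_sum big1_seq // => i /andP[Pi ir].
exact: dG.
Qed.

(** * Base-[p] digits and multi-indices *)

Fixpoint digits_rec (p k n : nat) : seq nat :=
  if k is k'.+1 then
    if n == 0%N then [::]
    else nseq (n %% p) 0%N ++ [seq e.+1 | e <- digits_rec p k' (n %/ p)]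
  else [::].

(** Each position occurs as often as its digit says. For [p > 1], [n] is enough fuel because
    division by [p] decreases it. *)
Definition digits p n := digits_rec p n n.

Lemma sum_digits p n : (1 < p)%N -> (\sum_(e <- digits p n) p ^ e)%N = n.
Proof.
move=> p1; suff H k : (n <= k)%N -> (\sum_(e <- digits_rec p k n) p ^ e)%N = n.
  exact: H.
elim: k n => [|k IH] n /=; first by rewrite leqn0 => /eqP->; rewrite big_nil.
case: eqVneq => [->|n0] nk; first by rewrite big_nil.
rewrite big_cat big_map big_nseq iter_addn_0 mul1n /=.
rewrite (eq_bigr (fun e => p * p ^ e)%N) => [|e _]; last by rewrite expnS.
rewrite -big_distrr IH /=; first by rewrite addnC mulnC -divn_eq.
by rewrite -ltnS; apply: leq_trans nk; rewrite ltn_Pdiv // lt0n.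
Qed.

Lemma count_digits p n e : (1 < p)%N -> (count_mem e (digits p n) < p)%N.
Proof.
move=> p1; rewrite /digits; move: {1}n => k; elim: k n e => [|k IH] n e /=; first exact: ltnW.
case: eqVneq => [_|n0]; first exact: ltnW.
rewrite count_cat count_nseq count_map; case: e => [|e] /=.
  rewrite mul1n (eq_count (a2 := pred0)) // count_pred0 addn0.
  by rewrite ltn_mod ltnW.
by rewrite mul0n add0n; apply: leq_ltn_trans (IH (n %/ p)%N e); apply: sub_count.
Qed.

Section MultiIndices.
Variables (F : finFieldType) (p d : nat).
Hypothesis hp : p \in [pchar F].
Local Notation Z := {poly F}.
Local Notation V := {ffun 'I_d -> Z}.
Local Notation slot := ('I_d * nat)%type.
Local Notation index := {ffun 'I_d -> nat}.
Implicit Types (s : index) (c : seq slot) (u h : V) (l : seq V).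

Let pP : prime p := pcharf_prime hp.
Let p_gt1 : (1 < p)%N := prime_gt1 pP.

Definition monomial u s : Z := \prod_(j < d) u j ^+ s j.

Definition slots s : seq slot :=
  flatten [seq [seq (j, e) | e <- digits p (s j)] | j <- enum 'I_d].

Lemma slot_mon_slots s u : slot_mon p (slots s) u = monomial u s.
Proof.
rewrite /slot_mon /slots big_flatten big_map big_enum; apply: eq_bigr => j _.
rewrite big_map -{2}(sum_digits (s j) p_gt1) /slot_val /=.
elim: (digits p (s j)) => [|e es IH]; first by rewrite !big_nil.
by rewrite !big_cons exprD IH.
Qed.

Definition exponent c : index := [ffun j => (\sum_(x <- c | x.1 == j) p ^ x.2)%N].

Lemma exponent_perm c c' : perm_eq c c' -> exponent c = exponent c'.
Proof. by move=> pc; apply/ffunP => j; rewrite !ffunE (perm_big _ pc). Qed.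

Lemma exponent_slots s : exponent (slots s) = s.
Proof.
apply/ffunP => j; rewrite ffunE /slots big_flatten big_map big_enum /=.
rewrite (bigD1 j) //= big_map /= eqxx sum_digits // big1 ?addn0 // => i /negPf ni.
by rewrite big_map /= ni big_pred0.
Qed.

Lemma exponent_shift v c j : exponent (shift_slots v c) j = (p ^ v * exponent c j)%N.
Proof.
rewrite !ffunE big_map big_distrr /=; apply: eq_bigr => x _.
by rewrite addnC expnD.
Qed.

Lemma count_slots s x : (count_mem x (slots s) < p)%N.
Proof.
case: x => j e; apply: leq_ltn_trans (count_digits (s j) e p_gt1).
rewrite /slots count_flatten -map_comp sumnE big_map big_enum /=.
rewrite (bigD1 j) //= big1 ?addn0 => [|i ni].
  rewrite count_map; apply: sub_count => e' /=; by case/eqP=> ->.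
apply/eqP; rewrite -leqn0 leqNgt -has_count -all_predC all_map.
by apply/allP => e' _ /=; apply: contra ni => /eqP[->].
Qed.

(** Without a slot of exponent 0, every summand of the base-[p] expansion of [s j] is divisible by
    [p]. *)
Lemma mem_slots0 s j : ~~ (p %| s j)%N -> (j, 0%N) \in slots s.
Proof.
move=> nd; apply/flattenP; exists [seq (j, e) | e <- digits p (s j)].
  by apply: map_f; rewrite mem_enum.
apply: map_f; apply: contraR nd => n0; rewrite -(sum_digits (s j) p_gt1).
rewrite big_seq; apply: dvdn_sum => -[|e] he; first by rewrite he in n0.
by rewrite expnS dvdn_mulr.
Qed.

Definition reduced s := [exists j, ~~ (p %| s j)%N].

(** Common factors [p] are divided out while they exist; the zero index is the one where this never
    ends. *)
Lemma reduce_index s : exists vs : nat * index,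
  (s = [ffun j => p ^ vs.1 * vs.2 j]%N) /\ (s != [ffun=> 0%N] -> reduced vs.2).
Proof.
have [n] := ubnP (\sum_j s j)%N; elim: n s => // n IH s; rewrite ltnS => sn.
have [->|s0] := eqVneq s [ffun=> 0%N].
  by exists (0%N, [ffun=> 0%N]); split=> //; apply/ffunP => j; rewrite !ffunE muln0.
have [rs|] := boolP (reduced s).
  by exists (0%N, s); split=> //; apply/ffunP => j; rewrite ffunE mul1n.
move=> /existsPn nr; pose t : index := [ffun j => s j %/ p]%N.
have st j : s j = (p * t j)%N.
  by rewrite ffunE mulnC divnK //; have := nr j; rewrite negbK.
have [j sj] : exists j, s j != 0%N.
  apply/existsP; apply: contraR s0 => /existsPn sz; apply/eqP/ffunP => j.
  by rewrite ffunE; apply/eqP; have := sz j; rewrite negbK.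
have [|[v t'] [/= tE rt]] := IH t.
  apply: leq_trans sn; rewrite (bigD1 j) // [ltnRHS](bigD1 j) //= -addSn leq_add //.
    by rewrite st ltn_Pmull // lt0n; apply: contra sj; rewrite st => /eqP->; rewrite muln0.
  by apply: leq_sum => i _; rewrite st leq_pmull // ltnW.
exists (v.+1, t'); split=> [|_] /=.
  by apply/ffunP => i; rewrite st tE !ffunE mulnA -expnS.
apply: rt; apply: contra sj => /eqP t0; by rewrite st t0 ffunE muln0.
Qed.

Variable T : zmodType.

Definition rational (a : Z -> T) := exists2 g, g != 0 & forall y, a (g * y) = 0.

(** By pigeonhole two powers of ['X] share a colour; freezing an argument at their difference
    multiplies [q] by a nonzero value. In the end only the slot [(j0, 0)] is left, which takes every
    polynomial as value, so [a] vanishes on the ideal of the final [q]. *)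
Lemma rational_of_finite_rank (a : Z -> T) j0 c q :
  q != 0 ->
  finite_rank (size c) (fun u l => a (q * slot_form p ((j0, 0%N) :: c) (u :: l))) ->
  rational a.
Proof.
elim: c q => [|x c IH] q q0 /=.
  move=> fr; exists q => // y; have := fr [ffun=> y].
  by rewrite /slot_form /= big_seq1 /slot_val ffunE expn0 expr1.
move=> [I [chi hchi]].
have [n [n' [nn' /hchi fr]]] : exists n n' : nat, n != n' /\
    chi [ffun=> 'X^n] = chi [ffun=> 'X^n'].
  pose f (i : 'I_#|I|.+1) := chi [ffun=> 'X^i].
  have /injectivePn[i [i' ni e]] : ~~ injectiveb f.
    apply/injectiveP => /leq_card; by rewrite card_ord ltnn.
  by exists i, i'.
pose h : V := [ffun=> 'X^n] - [ffun=> 'X^n'].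
have h0 : slot_val p x h != 0.
  rewrite /slot_val expf_neq0 // !ffunE subr_eq0; apply: contra nn' => /eqP.
  by move=> /(congr1 (fun f : Z => size f)); rewrite !size_polyXn => -[->].
apply: (IH (q * slot_val p x h)); first by rewrite mulf_neq0.
apply: eq_finite_rank fr => u l _; congr (a _).
by rewrite !slot_form_cons -mulrA; congr (_ * _); rewrite mulrCA.
Qed.

(** This makes a term periodic under shifts by multiples of [g] when its functional vanishes on the
    ideal of [g]. *)
Lemma monomial_modulo (g : Z) u h s :
  exists y, monomial (u + [ffun=> g] * h) s = monomial u s + g * y.
Proof.
pose K (x x' : Z) := exists y, x = x' + g * y.
have KM x1 x1' x2 x2' : K x1 x1' -> K x2 x2' -> K (x1 * x2) (x1' * x2').
  move=> [y1 ->] [y2 ->]; exists (x1' * y2 + y1 * x2' + y1 * g * y2); ring.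
have K1 : K 1 1 by exists 0; rewrite mulr0 addr0.
apply: (big_ind2 K) => // j _; rewrite !ffunE.
elim: (s j) => [|k IH]; first by rewrite !expr0.
by rewrite !exprS; apply: KM => //; exists (h j).
Qed.

Lemma slot_form_scale (g : V) c l : size c = size l ->
  slot_form p c [seq g * h | h <- l] = slot_form p c (nseq (size c) g) * slot_form p c l.
Proof.
elim: c l => [|x c IH] [|h l] //=; first by rewrite /slot_form big_nil mulr1.
by case=> sc; rewrite !slot_form_cons IH // slot_valM mulrACA.
Qed.
End MultiIndices.

Lemma seq_argmax (I : eqType) (f : I -> nat) (r : seq I) i0 : i0 \in r ->
  exists2 i, i \in r & forall j, j \in r -> (f j <= f i)%N.
Proof.
elim: r i0 => // i r IH i0 _; case: r IH => [|i1 r] IH.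
  by exists i; rewrite ?mem_head // => j; rewrite inE => /eqP->.
have [k kr kmax] := IH _ (mem_head i1 r).
have [le|/ltnW le] := leqP (f i) (f k).
  exists k; first by rewrite inE kr orbT.
  by move=> j; rewrite inE => /predU1P[->|/kmax].
exists i; first exact: mem_head.
by move=> j; rewrite inE => /predU1P[->|/kmax/leq_trans->].
Qed.

(** * Exponential sums of polynomials *)

Section PolynomialEquidistribution.
Variables (F : finFieldType) (p d : nat).
Hypothesis hp : p \in [pchar F].
Local Notation Z := {poly F}.
Local Notation V := {ffun 'I_d -> Z}.
Local Notation slot := ('I_d * nat)%type.
Local Notation index := {ffun 'I_d -> nat}.
Variable Fo : nat -> {fset V}.
Hypothesis hFo : folner Fo.
Variable e : 'F_p -> algC.
Hypothesis eD : {morph e : x y / x + y >-> x * y}.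
Hypothesis e_norm : forall x, `|e x| = 1.
Hypothesis e_inj : forall x, e x = 1 -> x = 0.

Let pP : prime p := pcharf_prime hp.

Lemma size_slots_gt0 (s : index) : reduced p s -> (0 < size (slots p s))%N.
Proof. by case/existsP=> j /(mem_slots0 hp); case: (slots p s). Qed.

(* Top-degree analysis: only the indices of [S] with the largest number of
   slots contribute to the multilinear form of order [m.+1]. *)
Lemma finite_rank_rational (S : seq index) (a : index -> Z -> 'F_p) (g : Z) m s0 :
  uniq S -> all (@reduced p d) S -> (forall s, {morph a s : y z / y - z}) -> g != 0 ->
  (forall s, s \in S -> size (slots p s) <= m.+1)%N ->
  s0 \in S -> size (slots p s0) = m.+1 ->
  finite_rank m (fun (x : V) (l : seq V) =>
     diffs (map (fun h => [ffun=> g] * h) (x :: l))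
           (fun u => \sum_(s <- S) a s (monomial u s)) 0) ->
  rational (a s0).
Proof.
move=> uS redS aB g0 leS s0S ss0 fr.
have [j0 nj0] := existsP (allP redS _ s0S).
set c1 := rem (j0, 0%N) (slots p s0).
have j0s := mem_slots0 hp nj0.
have sc1 : size c1 = m by rewrite size_rem // ss0.
pose c0 := (j0, 0%N) :: c1.
have pc0 : perm_eq c0 (slots p s0) by rewrite perm_sym perm_to_rem.
(* The terms of the polarized top-degree part; each ordering determines its index through
   [exponent]. *)
pose r := [seq (s, c') | s <- [seq s <- S | size (slots p s) == m.+1],
                         c' <- orderings m.+1 (slots p s)].
have rP i : i \in r -> [/\ i.1 \in S, perm_eq i.2 (slots p i.1), size i.2 = m.+1 &
                          exponent p i.2 = i.1].
  case/allpairsPdep=> s [c' [+ + ->]] /=; rewrite mem_filter => /andP[/eqP szs sS].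
  move=> /(orderings_perm szs) pc; rewrite (perm_size pc); split=> //.
  by rewrite (exponent_perm p pc) (exponent_slots hp).
pose Q c := slot_form p c (nseq (size c) [ffun=> g] : seq V).
have frQ : finite_rank m (weighted_form p r (fun i => a i.1) (fun i => i.2) Q).
  apply: eq_finite_rank fr => x l sl.
  move EL: (map _ (x :: l)) => L.
  have sL : size L = m.+1 by rewrite -EL size_map /= sl.
  rewrite diffs_sum /weighted_form big_allpairs_dep /= big_filter.
  rewrite (bigID (fun s => size (slots p s) == m.+1)) /= [X in _ + X]big1_seq ?addr0.
    apply: eq_bigr => s /eqP szs; rewrite diffs_comp //.
    rewrite -(eq_diffs L (slot_mon_slots hp s)) diffs_slot_mon ?szs //.
    rewrite additive_sum //; apply: eq_big_seq => c' /(orderings_perm szs) pc.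
    by rewrite -EL slot_form_scale //= (perm_size pc) szs sl.
  move=> s /andP[szs sS]; rewrite diffs_comp //.
  rewrite -(eq_diffs L (slot_mon_slots hp s)).
  have D : degree_lt m.+1 (slot_mon p (slots p s) : V -> Z).
    apply: (degree_ltW _ (@degree_lt_slot_mon _ _ _ hp (slots p s))).
    by rewrite ltn_neqAle szs leS.
  by rewrite D // additive0.
have Q0 : Q c0 != 0.
  rewrite /Q; elim: (c0) => [|x c IH] /=; first by rewrite /slot_form big_nil oner_eq0.
  by rewrite slot_form_cons mulf_neq0 // /slot_val ffunE expf_neq0.
have exc0 : exponent p c0 = s0 by rewrite (exponent_perm p pc0) (exponent_slots hp).
have scr i : i \in r -> size i.2 = m.+1 by case/rP.
have [i v ir|q q0 frq] := isolate hp (fun i : index * seq slot => aB i.1) scr sc1 Q0 frQ.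
  (* A shift by [v > 0] would make every component of the index divisible by [p], against
     [reduced]. *)
  have [/(allP redS)/existsP[j nj] _ _ exi] := rP _ ir => ei; move: nj.
  rewrite -exi ei exponent_shift; case: v {ei} => [|v]; last by rewrite expnS -mulnA dvdn_mulr.
  by move=> _; rewrite -[RHS]map_id; apply: eq_map => -[? ?]; rewrite /= addn0.
(* The surviving terms are the copies of [c0] among the orderings for [s0]; their number is
   invertible in ['F_p]. *)
have [g1 g10 g1P] : rational (fun y => a s0 y *+ count_mem c0 (orderings m.+1 (slots p s0))).
  apply: (rational_of_finite_rank (p := p) (j0 := j0) (c := c1) q0).
  rewrite sc1; apply: eq_finite_rank frq => u l _.
  rewrite big_mkcond big_allpairs_dep /= (bigD1_seq s0) ?filter_uniq //=; last first.
    by rewrite mem_filter ss0 eqxx.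
  rewrite -big_mkcond big_const_seq iter_addr_0 big1_seq ?addr0 // => s /andP[ns sS].
  rewrite big1_seq // => c' c'o; case: eqP => // ec; case/eqP: ns.
  have /rP[_ _ _ /= <-] : (s, c') \in r by apply/allpairsPdep; exists s, c'.
  by rewrite ec.
exists g1 => // y; have := g1P y.
have := count_orderings pP pc0 (count_slots hp s0); rewrite ss0.
set N := count_mem _ _ => pN; rewrite -mulr_natr => /eqP.
rewrite mulf_eq0 -(dvdn_pcharf (pchar_Fp pP)) (negPf pN) orbF => /eqP //.
Qed.

(** The condition on [S] says that no proper Frobenius power of the monomial of [l] occurs, so [l]
    keeps its own functional when indices with a common reduced part are merged. *)
Lemma negligible_polynomial (S : seq index) (lam : index -> Z -> 'F_p) (l : index) :
  uniq S -> (forall s, {morph lam s : y z / y - z}) -> l \in S ->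
  ~~ (p %| \sum_j l j)%N ->
  (forall s v, s \in S -> (forall j, s j = (p ^ v * l j)%N) -> v = 0%N) ->
  ~ rational (lam l) ->
  negligible Fo (fun u => e (\sum_(s <- S) lam s (monomial u s))).
Proof.
move=> uS lamB lS pl hS nrl.
have [red redP] : exists red : index -> nat * index, forall s,
    s = [ffun j => p ^ (red s).1 * (red s).2 j]%N /\
    (s != [ffun=> 0%N] -> reduced p (red s).2).
  exists (fun s => proj1_sig (constructive_indefinite_description _ (reduce_index hp s))).
  by move=> s; case: constructive_indefinite_description.
(* If [red s] is [(v, t)], the monomial of [s] is the [p ^ v]-th power of that of [t]; the power is
   absorbed into the functional. *)
pose a (s0 : index) y := \sum_(s <- S | (red s).2 == s0) lam s (y ^+ (p ^ (red s).1)).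
have pZ : p \in [pchar Z] by rewrite pchar_poly.
have aB s0 : {morph a s0 : y z / y - z}.
  move=> y z; rewrite /a -sumrB; apply: eq_bigr => s _; rewrite -lamB; congr (lam s _).
  elim: (red s).1 => [|v IH]; first by rewrite !expr1.
  rewrite expnSr !exprM IH -!(pFrobenius_autE pZ) pFrobenius_autB_comm //; exact: mulrC.
pose S0 := undup [seq (red s).2 | s <- S].
have fE u : \sum_(s <- S) lam s (monomial u s) = \sum_(s0 <- S0) a s0 (monomial u s0).
  rewrite /a (exchange_big_dep xpredT) //=; apply: eq_big_seq => s sS.
  have sS0 : (red s).2 \in S0 by rewrite mem_undup; apply/mapP; exists s.
  rewrite big_mkcond (bigD1_seq _ sS0) ?undup_uniq //= eqxx.
  rewrite big1 => [|i]; last by rewrite eq_sym => /negPf->.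
  rewrite addr0; congr (lam s _); rewrite /monomial -prodrXl.
  apply: eq_bigr => j _.
  by rewrite {1}(redP s).1 ffunE mulnC exprM.
(* The zero index is set aside: its monomial is constant and disappears under differences, whatever
   its functional. *)
pose irr s0 : bool := (s0 != [ffun=> 0%N]) &&
   ~~ (if excluded_middle_informative (rational (a s0)) then true else false).
have irrP s0 : irr s0 -> ~ rational (a s0).
  by rewrite /irr; case: excluded_middle_informative => [?|nr _]; rewrite ?andbF.
have nirrP s0 : s0 != [ffun=> 0%N] -> ~~ irr s0 -> rational (a s0).
  by rewrite /irr => ->; case: excluded_middle_informative.
pose S1 := [seq s <- S0 | irr s].
have redl v (t : index) : (forall j, l j = (p ^ v * t j)%N) -> v = 0%N.
  move=> lE; case: v lE => // v lE; case/negP: pl.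
  by apply: dvdn_sum => j _; rewrite lE expnS -mulnA dvdn_mulr.
have red0 (s t : index) : s = [ffun j => p ^ 0 * t j]%N -> s = t.
  by move->; apply/ffunP => j; rewrite ffunE mul1n.
have l0 : l != [ffun=> 0%N].
  apply: contra pl => /eqP->; rewrite big1 // => j _; exact: ffunE.
have redlE : red l = (0%N, l).
  have := (redP l).1; case: (red l) => v t /= lE.
  have v0 : v = 0%N by apply: (redl v t) => j; rewrite {1}lE ffunE.
  by rewrite v0 in lE *; rewrite -(red0 _ _ lE).
have alE y : a l y = lam l y.
  rewrite /a big_mkcond (bigD1_seq l) //= redlE eqxx expn0 expr1.
  rewrite big1_seq ?addr0 // => s /andP[nsl sS]; case: eqP => // rs; case/eqP: nsl.
  have sE := (redP s).1; rewrite rs in sE.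
  have v0 : (red s).1 = 0%N by apply: (hS s) => // j; rewrite {1}sE ffunE.
  by rewrite v0 in sE; apply: red0.
have lS1 : l \in S1.
  rewrite mem_filter mem_undup; apply/andP; split; last first.
    by apply/mapP; exists l; rewrite ?redlE.
  rewrite /irr l0; case: excluded_middle_informative => // -[g g0 ra].
  by case: nrl; exists g => // y; rewrite -alE.
(* A common [g] is the product of the polynomials witnessing rationality. *)
have [g g0 gP] : exists2 g : Z, g != 0 &
    forall s0, s0 \in S0 -> s0 != [ffun=> 0%N] -> ~~ irr s0 -> forall y, a s0 (g * y) = 0.
  elim: (S0) => [|s1 S2 [g g0 gP]]; first by exists 1; rewrite ?oner_eq0.
  have [[s1n nirr]|nn] := excluded_middle_informative
      ((s1 != [ffun=> 0%N]) /\ ~~ irr s1).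
    have [g1 g10 g1P] := nirrP _ s1n nirr.
    exists (g1 * g); first by rewrite mulf_neq0.
    move=> s; rewrite inE => /predU1P[->|sS] sn si y; first by rewrite -mulrA g1P.
    by rewrite -mulrA mulrCA gP.
  exists g => // s; rewrite inE => /predU1P[-> sn si|sS]; last exact: gP.
  by case: nn.
have redS1 : all (@reduced p d) S1.
  apply/allP => s; rewrite mem_filter mem_undup => /andP[/andP[sn _] /mapP[t tS sE]].
  rewrite sE; apply: (redP t).2; apply: contra sn => /eqP t0.
  apply/eqP/ffunP => j; have := congr1 (fun s : index => s j) (redP t).1.
  rewrite {1}t0 -sE !ffunE => /esym/eqP.
  by rewrite muln_eq0 expn_eq0 (gtn_eqF (prime_gt0 pP)) /= => /eqP.
(* [l] shows that [S1] is nonempty; the top degree may be attained at another index, which is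
   irrational as well. *)
have [s1 s1S1 s1max] : exists2 s1, s1 \in S1 &
    forall s, s \in S1 -> (size (slots p s) <= size (slots p s1))%N.
  exact: seq_argmax lS1.
have [m sm] : exists m, size (slots p s1) = m.+1.
  by exists (size (slots p s1)).-1; rewrite prednK // size_slots_gt0 // (allP redS1).
pose phi (h : V) : V := [ffun=> g] * h.
apply: null_seq_le (_ : negligible Fo (fun u => e (\sum_(s0 <- S0) a s0 (monomial u s0)))) => [N|].
  by rewrite (eq_avg _ (fun u => congr1 e (fE u))).
have phiB : {morph phi : h h' / h - h'} by move=> h h'; rewrite /phi mulrBr.
apply: (negligible_phase hFo eD e_norm e_inj phiB (m := m)
          (f' := fun u => \sum_(s0 <- S1) a s0 (monomial u s0))).
- move=> h u; rewrite /diff !big_filter -!sumrB [RHS]big_mkcond /=.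
  apply: eq_big_seq => s sS; case: ifP => // /negbT ni.
  have [y mE] := monomial_modulo g u h s.
  rewrite -aB /phi mE addrAC subrr add0r.
  have [s0|sn] := eqVneq s [ffun=> 0%N]; last exact: gP.
  have -> : g * y = 0; last exact: additive0 (aB s).
  apply: (addrI (monomial u s)); rewrite -mE addr0 s0 /monomial.
  by apply: eq_bigr => j _; rewrite !ffunE.
- apply: degree_lt_sum => s sS1 _; apply: degree_lt_comp => //.
  apply: (degree_ltW _ (eq_degree_lt (slot_mon_slots hp s) (@degree_lt_slot_mon _ _ _ hp _))).
  by rewrite ltnS -sm s1max.
- move=> fr; move: (s1S1); rewrite mem_filter => /andP[/irrP nr _]; apply: nr.
  by apply: finite_rank_rational fr => //; rewrite ?filter_uniq ?undup_uniq // -sm.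
Qed.
End PolynomialEquidistribution.

(** * Additive characters of a finite field *)

(** A coordinate of [F] as a vector space over ['F_p], chosen nonzero at 1, does the work of the
    trace. *)
Lemma exists_Fp_form (F : finFieldType) (p : nat) (hp : p \in [pchar F]) :
  exists2 rho : F -> 'F_p, {morph rho : x y / x - y} & exists x, rho x != 0.
Proof.
pose L := pPrimeCharType hp.
pose X := vbasis {:L}.
have [i ni] : exists i, coord X i (1 : L) != 0.
  apply/existsP; apply: contraT => /existsPn z.
  have := oner_neq0 F; rewrite [X in X != 0](coord_vbasis (memvf (1 : L))).
  rewrite big1 ?eqxx // => i _; have := z i; rewrite negbK => /eqP->.
  by rewrite scale0r.
exists (fun x : F => coord X i (x : L)); first by move=> x y; apply: (linearB (coord X i)).
by exists 1.
Qed.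

Lemma exists_Fp_character (p : nat) : prime p ->
  exists e : 'F_p -> algC, [/\ {morph e : x y / x + y >-> x * y},
    forall x, `|e x| = 1 & forall x, e x = 1 -> x = 0].
Proof.
move=> pP; have p0 := prime_gt0 pP; have [z zP] := C_prim_root_exists p0.
have Fc : (Zp_trunc (pdiv p)).+2 = p by exact: Fp_cast.
exists (fun x => z ^+ x); split=> [x y|x|x].
- by rewrite -exprD /= -(prim_expr_mod zP (x + y)); congr (z ^+ (_ %% _)).
- rewrite normrX; have -> : `|z| = 1; last exact: expr1n.
  have /eqP := congr1 Num.norm (prim_expr_order zP).
  by rewrite normrX normr1 pexpr_eq1 // => /eqP.
- move/eqP; rewrite -(prim_order_dvd zP) => px; apply: val_inj => /=.
  by apply/eqP; rewrite -leqn0 leqNgt; apply/negP => /dvdn_leq/(_ px);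
     rewrite leqNgt -[X in (_ < X)%N]Fc ltn_ord.
Qed.

(** * Weyl's criterion *)

Section Laurent.
Variable F : finFieldType.
Implicit Types (f g : {poly F}) (a : laurent F).

Lemma mulpl_widen k f a n : (size f <= k)%N ->
  mulpl f a n = \sum_(i < k) f`_i * a (n - (i : nat)%:Z).
Proof.
move=> le; rewrite /mulpl (big_ord_widen _ (fun i => f`_i * a (n - i%:Z)) le) big_mkcond.
apply: eq_bigr => i _; case: ltnP => // le'.
by rewrite nth_default // mul0r.
Qed.

Lemma mulplB a n : {morph (fun f => mulpl f a n) : f g / f - g}.
Proof.
move=> f g; pose k := maxn (size f) (size g).
rewrite !(@mulpl_widen k) ?leq_maxl ?leq_maxr //; last first.
  by apply: leq_trans (size_polyD _ _) _; rewrite size_polyN.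
by rewrite -sumrB; apply: eq_bigr => i _; rewrite coefB mulrBl.
Qed.

Lemma mulplZ c f a n : mulpl (c *: f) a n = c * mulpl f a n.
Proof.
rewrite (@mulpl_widen (size f) (c *: f)) ?size_scale_leq // mulr_sumr.
by apply: eq_bigr => i _; rewrite coefZ mulrA.
Qed.

Lemma mulplMXn f m a n : mulpl (f * 'X^m) a n = mulpl f a (n - m%:Z).
Proof.
rewrite (@mulpl_widen (m + size f)).
  rewrite big_split_ord /= big1 ?add0r => [|i _]; last first.
    by rewrite coefMXn ltn_ord mul0r.
  apply: eq_bigr => i _; rewrite coefMXn ltnNge leq_addr /= addKn.
  by rewrite PoszD opprD addrA.
have [->|f0] := eqVneq f 0; first by rewrite mul0r size_poly0.
by rewrite size_Mmonic ?monicXn // size_polyXn addnS addnC.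
Qed.

(** The coefficient of [f * a] at [-(m + 1)] is that of [t ^ m * f * a] at -1, so a combination of
    digits becomes one residue. *)
Lemma mulpl_test M (b : 'I_M -> F) f a :
  \sum_(m < M) b m * mulpl f a (- (m.+1 : nat)%:Z) =
  mulpl ((\sum_(m < M) b m *: 'X^m) * f) a (-1).
Proof.
rewrite mulr_suml (additive_sum (mulplB a (-1))).
apply: eq_bigr => m _; rewrite -scalerAl mulplZ (mulrC 'X^_) mulplMXn.
by congr (_ * mulpl _ _ _); lia.
Qed.

Lemma in_QP a G : is_laurent a -> G != 0 ->
  (forall n : nat, mulpl G a (- 1 - n%:Z) = 0) -> in_Q a.
Proof.
move=> [N aN] G0 neg.
(* From this bound on the coefficients of the product vanish, since those of [a] vanish above
   [N]. *)
exists (\poly_(i < `|N| + size G) mulpl G a i%:Z), G; split=> //.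
apply: functional_extensionality => n; rewrite /poly_laurent.
have [n0|n0] := lerP 0 n.
  rewrite coef_poly; have nE : n = (absz n)%:Z by rewrite gez0_abs.
  case: ltnP => le; first by rewrite -nE.
  rewrite /mulpl big1 // => i _; rewrite aN ?mulr0 //.
  have := ltn_ord i; lia.
have -> : n = - 1 - (absz (- 1 - n)%R)%:Z by lia.
by rewrite neg.
Qed.
End Laurent.

Section Weyl.
Variables (F : finFieldType) (d : nat).
Local Notation Z := {poly F}.
Local Notation V := {ffun 'I_d -> Z}.
Local Notation index := {ffun 'I_d -> nat}.

(** Indices of all degrees live in one type independent of [r], so that the double sum in [evalP]
    becomes a sum over one list. *)
Definition multi_indices (r : nat) : seq index :=
  [seq [ffun j => (s j : nat)] | s : {ffun 'I_d -> 'I_r.+1} <-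
     enum [pred s : {ffun 'I_d -> 'I_r.+1} | (\sum_(j < d) (s j : nat) == r)%N]].

Lemma evalPE (K : seq nat) (alpha0 : laurent F) (alpha : index -> laurent F) (u : V) n :
  evalP K alpha0 alpha u n = alpha0 n +
  \sum_(s <- flatten [seq multi_indices r | r <- 0%N :: K]) mulpl (monomial u s) (alpha s) n.
Proof.
rewrite /evalP big_flatten big_map; congr (_ + _); apply: eq_bigr => r _.
rewrite /multi_indices big_map big_enum; apply: eq_bigr => s _.
by congr (mulpl _ _ _); apply: eq_bigr => j _; rewrite ffunE.
Qed.

Lemma mem_multi_indices r s : (s \in multi_indices r) = (\sum_j s j == r)%N.
Proof.
apply/mapP/eqP => [[t]|sr].
  rewrite mem_enum inE => /eqP tr ->.
  by rewrite -[RHS]tr; apply: eq_bigr => j _; rewrite ffunE.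
have le j : (s j < r.+1)%N by rewrite ltnS -sr (bigD1 j) //= leq_addr.
exists [ffun j => Ordinal (le j)]; last by apply/ffunP => j; rewrite !ffunE.
rewrite mem_enum inE -[X in _ == X]sr; apply/eqP/eq_bigr => j _.
by rewrite ffunE.
Qed.

Lemma uniq_multi_indices (K : seq nat) :
  uniq K -> uniq (flatten [seq multi_indices r | r <- K]).
Proof.
elim: K => //= r K IH /andP[rK uK]; rewrite cat_uniq IH // andbT; apply/andP; split.
  rewrite map_inj_uniq ?enum_uniq // => s t /ffunP st.
  by apply/ffunP => j; apply: val_inj; have := st j; rewrite !ffunE.
apply/hasPn => s /flattenP[_ /mapP[r' r'K ->]]; rewrite !mem_multi_indices => /eqP->.
by apply: contra rK => /eqP<-.
Qed.

Variables (T : zmodType) (rho : F -> T) (e : T -> algC).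
Hypothesis rhoB : {morph rho : x y / x - y}.
Hypothesis rho0 : exists x, rho x != 0.
Hypothesis eD : {morph e : x y / x + y >-> x * y}.
Hypothesis e_norm : forall x, `|e x| = 1.
Hypothesis e_inj : forall x, e x = 1 -> x = 0.

Let rho_0 := additive0 rhoB.
Let rhoD := additiveD rhoB.

Let e_0 : e 0 = 1.
Proof.
have ne0 : e 0 != 0 by rewrite -normr_eq0 e_norm oner_eq0.
by apply: (mulfI ne0); rewrite -eD addr0 mulr1.
Qed.

Lemma sum_characters M (z : 'I_M -> F) :
  \sum_(b : {ffun 'I_M -> F}) e (rho (\sum_m b m * z m)) =
  (#|F| ^ M)%:R *+ [forall m, z m == 0].
Proof.
have e0 : e (rho 0) = 1 by rewrite rho_0 e_0.
have [/forallP z0|/forallPn[m zm]] := boolP [forall m, z m == 0].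
  rewrite (eq_bigr (fun=> 1)) => [|b _]; last first.
    by rewrite big1 // => m _; rewrite (eqP (z0 m)) mulr0.
  by rewrite sumr_const card_ffun card_ord.
have [x nx] := rho0.
(* The pairing of [b0] with [z] is [x], so translation by [b0] multiplies the sum by [e (rho x)],
   which is not 1. *)
pose b0 : {ffun 'I_M -> F} := [ffun i => if i == m then x / z m else 0].
set S := \sum_b _.
have SE : S = e (rho x) * S.
  rewrite {1}/S (reindex_inj (addIr b0)) mulr_sumr; apply: eq_bigr => b _.
  rewrite -eD -rhoD; congr (e (rho _)).
  have -> : \sum_i (b + b0) i * z i = \sum_i b i * z i + \sum_i b0 i * z i.
    by rewrite -big_split; apply: eq_bigr => i _; rewrite ffunE mulrDl.
  rewrite addrC (bigD1 m) //= ffunE eqxx divfK // big1 ?addr0 // => i /negPf ni.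
  by rewrite ffunE ni mul0r.
apply/eqP; have /eqP := SE; rewrite -[X in X == _]mul1r -subr_eq0 -mulrBl mulf_eq0.
rewrite subr_eq0 eq_sym => /orP[/eqP/e_inj rx|//].
by rewrite rx eqxx in nx.
Qed.

(** By orthogonality the indicator of a cylinder is an average of characters of the digits; [b = 0]
    contributes the density and all other [b] are negligible. *)
Lemma weyl_criterion (x : V -> laurent F) :
  (forall (Fo : nat -> {fset V}) M (b : {ffun 'I_M -> F}), folner Fo -> b != 0 ->
     negligible Fo (fun u => e (rho (\sum_(m < M) b m * x u (- (m.+1 : nat)%:Z))))) ->
  well_distributed x.
Proof.
move=> hx Fo hFo M a eps eps0.
pose E (b : {ffun 'I_M -> F}) u := e (rho (\sum_m b m * (x u (- (m.+1 : nat)%:Z) - a m))).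
have nE : null_seq (fun N => \sum_(b : {ffun 'I_M -> F} | b != 0) avg (Fo N) (E b)).
  apply: null_seq_sum => b nb.
  apply: null_seq_le (null_seqZ (e (rho (- \sum_m b m * a m))) (hx _ _ _ hFo nb)) => N.
  rewrite -avgZ (eq_avg _ (g2 := fun u => e (rho (- \sum_m b m * a m)) *
     e (rho (\sum_(m < M) b m * x u (- (m.+1 : nat)%:Z))))) // => u.
  rewrite /E -eD -rhoD addrC -sumrB; congr (e (rho _)).
  by apply: eq_bigr => m _; rewrite mulrBr.
have q0 : (#|F| ^ M)%:R != 0 :> algC.
  by rewrite pnatr_eq0 -lt0n expn_gt0; apply/orP; left; apply/card_gt0P; exists 0.
(* Halving [eps] turns the weak bound of [null_seq] into the strict one of [rat_cvg]. *)
have [N0 hN] := null_seqZ ((#|F| ^ M)%:R^-1) nE (divr_gt0 eps0 (ltr0n _ 2)).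
exists N0 => N /hN le_eps.
suff : `|ratr (#|` [fset u in Fo N | in_cylinder a (x u)]%fset|%:R / #|` Fo N|%:R
     - #|F|%:R ^- M)| <= ratr (eps / 2%:R) :> algC.
  rewrite -ratr_norm ler_rat => /le_lt_trans->//.
  by rewrite ltr_pdivrMr // ltr_pMr // ltr1n.
apply: le_trans le_eps; rewrite le_eqVlt; apply/orP; left; apply/eqP; congr `|_|.
set A := Fo N; have A0 : (A != fset0)%fset by apply: hFo.1.
have -> : \sum_(b : {ffun 'I_M -> F} | b != 0) avg A (E b) = \sum_b avg A (E b) - 1.
  rewrite [in RHS](bigD1 (0 : {ffun 'I_M -> F})) //= (eq_avg _ (g2 := fun=> 1)) => [|u].
    by rewrite avg_cst // [1 + _]addrC addrK.
  rewrite /E big1 => [|m _]; last by rewrite ffunE mul0r.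
  by rewrite rho_0 e_0.
rewrite -avg_sum (eq_avg _ (g2 := fun u => (#|F| ^ M)%:R * (in_cylinder a (x u))%:R)); last first.
  move=> u; rewrite /E sum_characters mulr_natr; congr (_ *+ nat_of_bool _).
  by apply: eq_forallb => m; rewrite subr_eq0.
have -> : avg A (fun u => (#|F| ^ M)%:R * (in_cylinder a (x u))%:R) =
    (#|F| ^ M)%:R * (#|` [fset u in A | in_cylinder a (x u)]%fset|%:R / #|` A|%:R).
  rewrite avgZ; congr (_ * (_ / _)).
  rewrite -natr_sum -big_mkcond big_fset_condE sum1_size //.
rewrite mulrBr mulKf // mulr1 rmorphB fmorph_div fmorphV rmorphXn /= !ratr_nat.
by rewrite natrX.
Qed.
End Weyl.

(** * Well-distribution of polynomial sequences *)

Unset Implicit Arguments. Set Strict Implicit. Set Printing Implicit Defensive.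

Theorem theorem3p1 (F : finFieldType) (p : nat) (hp : p \in [pchar F])
  (d : nat) (K : seq nat) (hKu : uniq K) (hKpos : all (fun r => 0 < r)%N K)
  (alpha0 : laurent F) (alpha : {ffun 'I_d -> nat} -> laurent F)
  (halpha0 : is_laurent alpha0) (halpha : forall s, is_laurent (alpha s))
  (k : nat) (hk : k \in K) (l : {ffun 'I_d -> nat})
  (hl : (\sum_(j < d) l j)%N = k)
  (hi : ~~ (p %| k)%N)
  (hii : forall v : nat, (0 < v)%N -> (p ^ v * k)%N \notin K)
  (hiii : ~ in_Q (alpha l)) :
  well_distributed (evalP K alpha0 alpha).
Proof.
have [rho rhoB rho0] := exists_Fp_form hp.
have [e [eD e_norm e_inj]] := exists_Fp_character (pcharf_prime hp).
apply: (weyl_criterion rhoB rho0 eD e_norm e_inj) => Fo M b hFo nb.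
(* [B] encodes the character [b]: the combination of digits of a series is the coefficient at -1 of
   [B] times that series. *)
pose B : {poly F} := \sum_(m < M) b m *: 'X^m.
have B0 : B != 0.
  apply: contra nb => /eqP B0; apply/eqP/ffunP => m; rewrite ffunE.
  have := congr1 (fun f : {poly F} => f`_m) B0; rewrite coef0 coef_sum => <-.
  rewrite (bigD1 m) //= coefZ coefXn eqxx mulr1 big1 ?addr0 // => i ni.
  by rewrite coefZ coefXn eq_sym (negPf (ni : i != m :> nat)) mulr0.
pose lam s y := rho (mulpl (B * y) (alpha s) (-1)).
pose S := flatten [seq multi_indices d r | r <- 0%N :: K].
have lamB s : {morph lam s : y z / y - z}.
  by move=> y z; rewrite /lam mulrBr -rhoB; congr rho; apply: mulplB.
have SP s : s \in S -> (\sum_j s j)%N \in 0%N :: K.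
  by case/flattenP=> _ /mapP[r rK ->]; rewrite mem_multi_indices => /eqP->.
have lS : l \in S.
  apply/flattenP; exists (multi_indices d k); first by rewrite map_f // inE hk orbT.
  by rewrite mem_multi_indices hl.
have uS : uniq S.
  apply: uniq_multi_indices; rewrite /= hKu andbT.
  by apply/negP => /(allP hKpos).
have k0 : (0 < k)%N by apply: (allP hKpos).
have nrl : ~ rational (lam l).
  move=> [g g0 rg]; apply: hiii; apply: (in_QP (G := B * g)) => //.
    by rewrite mulf_neq0.
  (* If a negative coefficient of [B * g] times [alpha l] were nonzero, a constant multiple of
     ['X^n] would move it to position -1 and rescale it to [x], where [rho] is nonzero. *)
  move=> n; apply/eqP; apply: contraT => nz; have [x nx] := rho0.
  have := rg ((x / mulpl (B * g) (alpha l) (- 1 - n%:Z)) *: 'X^n).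
  rewrite /lam mulrA -scalerAr mulplZ mulplMXn divfK // => /eqP.
  by rewrite (negPf nx).
pose c := rho (\sum_(m < M) b m * alpha0 (- (m.+1 : nat)%:Z)).
have := negligible_polynomial hp hFo eD e_norm e_inj uS lamB lS _ _ nrl.
rewrite hl => /(_ hi) neg.
apply: null_seq_le (null_seqZ (e c) (neg _)) => [N|s v sS sl].
  rewrite -avgZ (eq_avg _ (g2 := fun u => e c * e (\sum_(s <- S) lam s (monomial u s)))) // => u.
  rewrite -eD -(additive_sum rhoB) -(additiveD rhoB); congr (e (rho _)).
  under eq_bigr do rewrite evalPE mulrDr.
  rewrite big_split /=; congr (_ + _); under eq_bigr do rewrite mulr_sumr.
  by rewrite exchange_big; apply: eq_bigr => s _; rewrite mulpl_test.
(* If [s] is [p ^ v] times [l], its degree [p ^ v * k] is positive, hence lies in [K]; condition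
   (ii) leaves only [v = 0]. *)
move: (SP _ sS).
have -> : (\sum_j s j = p ^ v * k)%N.
  by rewrite -hl big_distrr; apply: eq_bigr => j _; apply: sl.
rewrite inE muln_eq0 expn_eq0 (gtn_eqF k0) orbF.
rewrite (gtn_eqF (prime_gt0 (pcharf_prime hp))) /=.
by case: v {sl} => // v; rewrite (negPf (hii _ _)).
Qed.
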